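(* (I) A function $f:\mathbb R\to\mathbb R$ belongs to the class $\mathcal F_{1,2}$ if and only if there exists a (nonnegative, possibly infinite) Borel measure $\gamma=\gamma_f$ on $(0,\infty]$ such that $\int_{(0,\infty]}(t\wedge1)\,\gamma(dt)<\infty$ and $$f(x)=\int_{(0,\infty]}\psi_t(x)\,\gamma(dt)\quad\text{for all }x\in\mathbb R,$$ where $\psi_t(x):=x^2-(|x|-t)_+^2$ for $t\in(0,\infty]$ and $x\in\mathbb R$. Also, $\frac1{2t}\psi_t(x)\to|x|$ as $t\downarrow0$, uniformly in $x\in\mathbb R$. (II) For each $f\in\mathcal F_{1,2}$, the corresponding measure $\gamma=\gamma_f$ is unique and determined by the condition that $\gamma\big((x,\infty]\big)=\frac12 f''(x)$ for all $x\in(0,\infty)$. (III) For any $f\in\mathcal F_{1,2}$ and $x\in[0,\infty)$, $$f'(x)=\int_{(0,\infty]}\psi_t'(x)\,\gamma(dt)=2\int_{(0,\infty]}(x\wedge t)\,\gamma(dt),$$ where $\gamma=\gamma_f$.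
   Context: $\mathcal F_{1,2}$ is the class of all continuously differentiable functions $f:\mathbb R\to\mathbb R$ such that $f(0)=0$, $f$ is even, and $f'$ is nondecreasing and concave on $[0,\infty)$. On $(0,\infty)$, $f''$ denotes the right derivative of $f'$. Conventions: $u\wedge v=\min(u,v)$, $u_+:=\max(0,u)$, $u_+^2:=(u_+)^2$, $u-\infty:=-\infty$ and $(-\infty)_+:=0$ for real $u$; thus $\psi_\infty(x)=x^2$ for all real $x$. $\psi_t'$ is the derivative of $\psi_t$ in $x$. *)

(* Defs.v *)
From mathcomp Require Export all_boot all_order all_algebra.
From mathcomp Require Export all_classical all_reals all_analysis.
From mathcomp Require Export measurable_realfun.

Set Implicit Arguments.
Unset Strict Implicit.
Unset Printing Implicit Defensive.

Import Order.TTheory GRing.Theory Num.Theory.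
Import numFieldNormedType.Exports.

Local Open Scope classical_set_scope.
Local Open Scope ring_scope.

(* Concavity of f' is convexity of - f'. *)
Definition F12 (R : realType) (f : R -> R) : Prop :=
  [/\ (forall x : R, derivable f x 1) /\ continuous (derive1 f),
      f 0 = 0,
      (forall x : R, f (- x) = f x),
      {in `[0, +oo[ &, nondecreasing_fun (derive1 f)} &
      convex_function (`[0, +oo[%classic : set R) (\- derive1 f)].

Definition rquot (R : realType) (g : R -> R) (x h : R) : R :=
  h^-1 * (g (h + x) - g x).

(* Right derivative; meaningful when [rquot g x] converges at [0^'+]. *)
Definition rderive1 (R : realType) (g : R -> R) (x : R) : R :=
  lim (rquot g x @ 0^'+).

(* The extended-real subtraction and maximum give [psi +oo x = x ^+ 2]; the
   argument of [fine] is finite for every [t] in ]0, +oo]. *)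
Definition psi (R : realType) (t : \bar R) (x : R) : R :=
  x ^+ 2 - fine (maxe 0%E (`|x|%:E - t)%E) ^+ 2.

Definition pos_ereal (R : realType) : set (\bar R) := `]0%E, +oo%E]%classic.
Arguments pos_ereal {R}.

(* A Borel measure on ]0, +oo] is encoded as a Borel measure on [\bar R] which
   vanishes off ]0, +oo]; two such measures are equal when they agree on all
   Borel sets (nothing is said of their values on nonmeasurable sets). *)
Definition on_pos_ereal (R : realType)
    (gamma : {measure set (\bar R) -> \bar R}) : Prop :=
  gamma (~` pos_ereal) = 0%E.

Definition represents (R : realType)
    (gamma : {measure set (\bar R) -> \bar R}) (f : R -> R) : Prop :=
  [/\ on_pos_ereal gamma,
      (\int[gamma]_(t in pos_ereal) mine t 1 < +oo)%E &
      forall x : R, (f x)%:E = (\int[gamma]_(t in pos_ereal) (psi t x)%:E)%E].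

(* Main.v *)
Require Import Defs.
From mathcomp Require Import ring lra.
Import Order.TTheory GRing.Theory Num.Theory.
Import numFieldNormedType.Exports.
Set Implicit Arguments.
Unset Strict Implicit.
Unset Printing Implicit Defensive.
Local Open Scope classical_set_scope.
Local Open Scope ring_scope.

(** For t > 0 the kernel [psi t] is even, convex and of class C^1, and on
    [0, +oo[ its derivative is 2 (x /\ t), which is nondecreasing and concave
    in x. Integrating in t preserves all of this once t /\ 1 is integrable:
    with P x the integral of [psi t x] and H x that of its derivative
    [dpsi t x], the pointwise subgradient inequality
    [psi t y - psi t x >= dpsi t x * (y - x)] integrates to
    [P y - P x >= H x * (y - x)], and a function with a continuous
    subgradient is differentiable with that derivative
    ([is_derive_subgradient]). Hence P' = H and every representable function
    is in the class ([F12_int_psi]).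

    The link between f and gamma is the tail x |-> gamma ]x, +oo]. On
    [0, +oo[, between x <= y, the increment of [dpsi t] is at most 2 (y - x)
    if t > x and 0 otherwise, and at least 2 (y - x) if t > y
    ([dpsi_incr]); integrated, this reads
        2 (y - x) gamma ]y, +oo] <= H y - H x <= 2 (y - x) gamma ]x, +oo].
    Letting y decrease to x identifies the right derivative of H with twice the
    tail ([tail_int_dpsi]), so f determines all tails at positive points. These
    tails are finite and the rays generate the Borel sets, so f determines gamma
    ([measure_eq_of_tails]).

    Conversely, a concave f' satisfies the very same two inequalities with
    f'' in place of 2 gamma ]x, +oo] ([increment_rderive1]). Two functions whose
    increments are squeezed in this way by a common function D have the same
    increments: over n equal steps the errors telescope to
    (D a - D b) (b - a) / n ([increment_unique]). Therefore, if gamma has tails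
    f'' / 2, the integral of [dpsi t x - dpsi t e] is f' x - f' e for
    0 < e <= x, and monotone convergence as e tends to 0 gives H = f' on
    [0, +oo[, including the integrability of t /\ 1 ([int_dpsi_of_tail]);
    oddness and integration then give P = f.

    It remains to produce a measure with tails G = f'' / 2. As G is
    nonnegative, nonincreasing and right-continuous on ]0, +oo[, this is the
    quantile transform: the image of Lebesgue measure on ]0, +oo[ under the
    generalized inverse of G ([measure_of_tails]). *)

(** * The kernel psi and its derivative *)

(** The derivative of [psi t] when t > 0: twice the truncation of x to [-t, t].
    The argument of [fine] is then finite, even for t = +oo, since x is real. *)
Definition dpsi (R : realType) (t : \bar R) (x : R) : R :=
  2 * fine (maxe (- t) (mine x%:E t))%E.

Lemma pos_erealE (R : realType) (t : \bar R) : pos_ereal t <-> (0 < t)%E.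
Proof. by rewrite /pos_ereal/= in_itv/= leey andbT. Qed.

Lemma dpsi_fin (R : realType) (r x : R) :
  dpsi r%:E x = 2 * Num.max (- r) (Num.min x r).
Proof. by rewrite /dpsi -EFinN -EFin_min -EFin_max. Qed.

Lemma dpsi_oo (R : realType) (x : R) : dpsi +oo%E x = 2 * x.
Proof. by rewrite /dpsi miney /= maxNye. Qed.

Lemma psi_fin (R : realType) (r x : R) :
  psi r%:E x = x ^+ 2 - Num.max 0 (`|x| - r) ^+ 2.
Proof. by rewrite /psi -EFinB -EFin_max. Qed.

Lemma psi_oo (R : realType) (x : R) : psi +oo%E x = x ^+ 2.
Proof. by rewrite /psi addeNy maxeNy /= expr0n subr0. Qed.

(** The three regimes of the pair ([dpsi t x], [psi t x]): quadratic for
    |x| <= t, affine beyond. Elementary inequalities about the kernel are all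
    checked regime by regime. *)
Variant truncation_spec (R : realType) (r x : R) : R -> R -> Prop :=
| Truncation_lo of x < - r :
    truncation_spec r x (- (2 * r)) (- (2 * r * x) - r ^+ 2)
| Truncation_mid of - r <= x & x <= r : truncation_spec r x (2 * x) (x ^+ 2)
| Truncation_hi of r < x : truncation_spec r x (2 * r) (2 * r * x - r ^+ 2).

Lemma truncationP (R : realType) (r x : R) : 0 < r ->
  truncation_spec r x (dpsi r%:E x) (psi r%:E x).
Proof.
move=> r0; rewrite dpsi_fin psi_fin.
have [xr|rx] := leP x r.
  have [xNr|Nrx] := ltP x (- r).
    rewrite max_r ltr0_norm; try lra.
    have -> : 2 * - r = - (2 * r) by ring.
    have -> : x ^+ 2 - (- x - r) ^+ 2 = - (2 * r * x) - r ^+ 2 by ring.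
    by constructor.
  have xr' : `|x| <= r by rewrite ler_norml Nrx.
  rewrite max_l; last lra.
  by rewrite expr0n subr0; constructor.
rewrite max_r; last lra.
rewrite max_r gtr0_norm; try lra.
have -> : x ^+ 2 - (x - r) ^+ 2 = 2 * r * x - r ^+ 2 by ring.
by constructor.
Qed.

(** Seen from a bounded window, the level t = +oo cannot be told from a large
    finite one; this reduces inequalities between finitely many values of the
    kernel to a real level. *)
Lemma finite_level (R : realType) (t : \bar R) (b : R) : (0 < t)%E ->
  exists2 r : R, 0 < r & forall z, `|z| <= b ->
    [/\ psi t z = psi r%:E z, dpsi t z = dpsi r%:E z &
        (z%:E < t)%E = (z < r)].
Proof.
case: t => [r||] //; first by rewrite lte_fin => r0; exists r.
have b0 : 0 < `|b| + 1 by rewrite ltr_pwDr.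
move=> _; exists (`|b| + 1) => // z zb.
have /andP[zb1 zb2] : - (`|b| + 1) < z < `|b| + 1.
  by rewrite -ltr_norml (le_lt_trans zb)// (le_lt_trans (ler_norm b))// ltrDl.
rewrite psi_oo dpsi_oo ltry zb2.
by case: truncationP => // *; split=> //; lra.
Qed.

(** Convexity of [psi t] in the form that survives integration in t without any
    differentiation under the integral sign. *)
Lemma subgradient_psi (R : realType) (t : \bar R) (x y : R) : (0 < t)%E ->
  dpsi t x * (y - x) <= psi t y - psi t x.
Proof.
move=> /(@finite_level _ _ (Num.max `|x| `|y|))[r r0 tr].
have [|-> -> _] := tr x; first by rewrite le_max lexx.
have [|-> _ _] := tr y; first by rewrite le_max lexx orbT.
(* For y in the quadratic regime the gap is (y + r)^2, (y - x)^2 or (y - r)^2. *)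
have := sqr_ge0 (y + r); have := sqr_ge0 (y - r); have := sqr_ge0 (x - y).
by case: truncationP => // *; case: truncationP => // *; nra.
Qed.

Lemma psi_ge0 (R : realType) (t : \bar R) (x : R) : (0 < t)%E -> 0 <= psi t x.
Proof.
move=> /(@finite_level _ _ `|x|)[r r0 tr].
by have [//|-> _ _] := tr x; case: truncationP => // *; nra.
Qed.

Lemma psi0 (R : realType) (t : \bar R) : (0 < t)%E -> psi t 0 = 0.
Proof.
move=> t0; apply/eqP; rewrite eq_le psi_ge0// andbT.
have := @subgradient_psi R t 0 1 t0; have := @subgradient_psi R t 0 (-1) t0.
move: t0 => /(@finite_level _ _ 0)[r r0 tr].
have [|-> -> _] := tr 0; first by rewrite normr0.
by case: truncationP => // *; nra.
Qed.

Lemma psiN (R : realType) (t : \bar R) (x : R) : psi t (- x) = psi t x.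
Proof. by rewrite /psi normrN sqrrN. Qed.

Lemma dpsiN (R : realType) (t : \bar R) (x : R) : (0 < t)%E ->
  dpsi t (- x) = - dpsi t x.
Proof.
move=> /(@finite_level _ _ `|x|)[r r0 tr].
have [|_ -> _] := tr x => //; have [|_ -> _] := tr (- x); first by rewrite normrN.
by case: truncationP => // *; case: truncationP => // *; lra.
Qed.

Lemma dpsi0 (R : realType) (t : \bar R) : (0 < t)%E -> dpsi t 0 = 0.
Proof. by move=> t0; have := dpsiN 0 t0; rewrite oppr0; lra. Qed.

Lemma dpsi_ge0E (R : realType) (t : \bar R) (x : R) : (0 < t)%E -> 0 <= x ->
  (dpsi t x)%:E = (2%:E * mine x%:E t)%E.
Proof.
case: t => [r||] //; last by move=> *; rewrite dpsi_oo miney EFinM.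
rewrite lte_fin => r0 x0; rewrite dpsi_fin max_r; last by rewrite le_min; lra.
by rewrite -EFin_min EFinM.
Qed.

(** The mass at level t contributes to the slope between x and y exactly through
    its position: fully if t > y, not at all if t <= x. Integrated in t, this
    brings in the tails of the measure. *)
Lemma dpsi_incr (R : realType) (t : \bar R) (x y : R) : (0 < t)%E ->
  0 <= x -> x <= y ->
  2 * (y - x) * (y%:E < t)%E%:R <= dpsi t y - dpsi t x
  <= 2 * (y - x) * (x%:E < t)%E%:R.
Proof.
move=> + x0 xy => /(@finite_level _ _ (Num.max `|x| `|y|))[r r0 tr].
have [|_ -> ->] := tr x; first by rewrite le_max lexx.
have [|_ -> ->] := tr y; first by rewrite le_max lexx orbT.
case: truncationP => // *; case: truncationP => // *.
all: by have [?|?] := ltP x r; have [?|?] := ltP y r; rewrite ?mulr1 ?mulr0;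
  try lra; apply/andP; split; lra.
Qed.

Lemma dpsi_le (R : realType) (t : \bar R) : (0 < t)%E ->
  {homo dpsi t : x y / x <= y}.
Proof.
move=> t0 x y xy; move: t0 => /(@finite_level _ _ (Num.max `|x| `|y|))[r r0 tr].
have [|_ -> _] := tr x; first by rewrite le_max lexx.
have [|_ -> _] := tr y; first by rewrite le_max lexx orbT.
by case: truncationP => // *; case: truncationP => // *; lra.
Qed.

Lemma dpsi_lip (R : realType) (t : \bar R) (x y : R) : (0 < t)%E ->
  `|dpsi t x - dpsi t y| <= 2 * `|x - y|.
Proof.
move=> /(@finite_level _ _ (Num.max `|x| `|y|))[r r0 tr].
have [|_ -> _] := tr x; first by rewrite le_max lexx.
have [|_ -> _] := tr y; first by rewrite le_max lexx orbT.
rewrite ler_norml; have := ler_norm (x - y); have := ler_norm (- (x - y)).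
rewrite normrN.
by case: truncationP => // *; case: truncationP => // *; lra.
Qed.

Lemma dpsi_concave (R : realType) (t : \bar R) (s x y : R) : (0 < t)%E ->
  0 <= x -> 0 <= y -> 0 <= s <= 1 ->
  s * dpsi t x + (1 - s) * dpsi t y <= dpsi t (s * x + (1 - s) * y).
Proof.
move=> t0 x0 y0 s01; set z := s * x + _.
have z0 : 0 <= z by rewrite /z; nra.
move: t0 => /(@finite_level _ _ (Num.max z (Num.max x y)))[r r0 tr].
have [|_ -> _] := tr x; first by rewrite ger0_norm// !le_max lexx orbT.
have [|_ -> _] := tr y; first by rewrite ger0_norm// !le_max lexx !orbT.
have [|_ -> _] := tr z; first by rewrite ger0_norm// !le_max lexx.
rewrite /z in z0 *.
by case: truncationP => // *; case: truncationP => // *;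
  case: truncationP => // *; nra.
Qed.

(** All levels x are dominated by the level 1, so that integrability of t /\ 1
    is enough to integrate every [dpsi t x]. *)
Lemma dpsi_le_scale (R : realType) (t : \bar R) (x : R) : (0 < t)%E ->
  `|dpsi t x| <= (1 + `|x|) * dpsi t 1.
Proof.
move=> /(@finite_level _ _ (Num.max `|x| `|1|))[r r0 tr].
have [|_ -> _] := tr x; first by rewrite le_max lexx.
have [|_ -> _] := tr 1; first by rewrite le_max lexx orbT.
rewrite ler_norml; have := ler_norm x; have := ler_norm (- x); rewrite normrN.
have := normr_ge0 x.
by case: truncationP => // *; case: truncationP => // *; nra.
Qed.

(** A Markov-type bound: tails at positive points are finite as soon as [dpsi]
    is integrable. *)
Lemma indic_le_dpsi (R : realType) (t : \bar R) (x : R) : (0 < t)%E -> 0 < x ->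
  (x%:E < t)%E%:R <= x^-1 * dpsi t x.
Proof.
move=> /(@finite_level _ _ `|x|)[r r0 tr] x0.
have [|_ -> ->] := tr x => //.
rewrite mulrC ler_pdivlMr//.
by case: truncationP => // *; case: ltP => // ?; rewrite ?mul1r ?mul0r; lra.
Qed.

Lemma continuous_dpsi (R : realType) (t : \bar R) : (0 < t)%E ->
  continuous (dpsi t).
Proof.
move=> t0 x; apply/cvgrPdist_le => e e0; near=> y.
apply: (le_trans (dpsi_lip _ _ t0)).
rewrite mulrC -ler_pdivlMr//.
by near: y; apply: cvgr_dist_le => //; rewrite divr_gt0.
Unshelve. all: by end_near. Qed.

(** The difference quotient at x lies between H x and H (x + h), by the
    subgradient inequality at both ends, and H is continuous. *)
Lemma is_derive_subgradient (R : realType) (P H : R -> R) :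
  (forall x y, H x * (y - x) <= P y - P x) -> continuous H ->
  forall x : R, is_derive x 1 P (H x).
Proof.
move=> PH cH x.
suff : h^-1 *: ((P \o shift x) (h *: 1) - P x) @[h --> 0^'] --> H x.
  by move=> cv; apply: DeriveDef; [apply/cvg_ex; exists (H x)|exact: cvg_lim].
apply/cvgrPdist_le => e e0; near=> h.
have h0 : h != 0 by near: h; exact: nbhs_dnbhs_neq.
have He : `|H x - H (h + x)| <= e.
  near: h; apply: nbhs_dnbhs.
  have Hx : H (h + x) @[h --> 0] --> H x.
    have -> : H x = H (0 + x) by rewrite add0r.
    apply: (@cvg_comp _ _ _ (+%R^~ x) H _ (nbhs (0 + x))); last exact: cH.
    by apply: cvgD => //; exact: cvg_cst.
  have Hy : \forall h \near (0 : R), `|H x - H (h + x)| <= e.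
    exact: ((cvgrPdist_le (V := R^o) (fun h : R => H (h + x)) (H x)).1 Hx e e0).
  exact: Hy.
rewrite /= scaler1 /GRing.scale /=; apply: le_trans He.
have := PH x (h + x); have := PH (h + x) x.
rewrite addrK (_ : x - (h + x) = - h); last by ring.
move: h0; rewrite neq_lt => /orP[h0|h0].
- have -> : h^-1 * (P (h + x) - P x) = (P x - P (h + x)) / - h.
    by field; lra.
  move=> A B.
  have : H (h + x) <= (P x - P (h + x)) / - h by rewrite ler_pdivlMr; lra.
  have : (P x - P (h + x)) / - h <= H x by rewrite ler_pdivrMr; lra.
  by move=> *; rewrite !ger0_norm; lra.
- rewrite mulrC => A B.
  have : H x <= (P (h + x) - P x) / h by rewrite ler_pdivlMr; lra.
  have : (P (h + x) - P x) / h <= H (h + x) by rewrite ler_pdivrMr; lra.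
  by move=> *; rewrite !ler0_norm; lra.
Unshelve. all: by end_near. Qed.

Lemma is_derive_psi (R : realType) (t : \bar R) (x : R) : (0 < t)%E ->
  is_derive x 1 (psi t) (dpsi t x).
Proof.
move=> t0; apply: is_derive_subgradient; last exact: continuous_dpsi.
by move=> *; exact: subgradient_psi.
Qed.

Lemma derive1_psi (R : realType) (t : \bar R) (x : R) : (0 < t)%E ->
  derive1 (psi t) x = dpsi t x.
Proof.
by move=> t0; rewrite derive1E; apply: derive_val; exact: is_derive_psi.
Qed.

(** The value psi_t(x) / (2 t) lies between |x| - t / 2 and |x|, a bound that
    is uniform in x. *)
Lemma cvg_psi_abs (R : realType) :
  {uniform, (fun t x : R => (2 * t)^-1 * psi t%:E x) @ 0^'+ -->
             (fun x : R => `|x|)}.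
Proof.
move=> P /= /uniform_nbhs[E [entE EP]].
move: entE; rewrite -entourage_from_ballE => -[/= e e0 eE].
near=> t; apply: EP => /= x _; apply: eE => /=.
have t0 : 0 < t by near: t; exact: nbhs_right_gt.
have te : t < e by near: t; exact: nbhs_right_lt.
rewrite /ball/= psi_fin; move: (normr_ge0 x); rewrite -(real_normK (num_real x)).
set a := `|x|; move=> a0.
have -> : (2 * t)^-1 * (a ^+ 2 - Num.max 0 (a - t) ^+ 2) =
    (a ^+ 2 - Num.max 0 (a - t) ^+ 2) / (2 * t) by rewrite mulrC.
suff : a - t / 2 <= (a ^+ 2 - Num.max 0 (a - t) ^+ 2) / (2 * t) <= a.
  by move=> /andP[A B]; rewrite ger0_norm; lra.
rewrite ler_pdivlMr ?ler_pdivrMr; try lra.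
by have [H|H] := leP 0 (a - t); nra.
Unshelve. all: by end_near. Qed.

(** * Right derivatives of concave functions *)

(** Concavity on [0, +oo[ as comparison of consecutive slopes, with the
    denominators cleared. *)
Definition chord_concave (R : realType) (g : R -> R) :=
  forall x y z : R, 0 <= x -> x < y -> y < z ->
    (g z - g y) * (y - x) <= (g y - g x) * (z - y).

Lemma F12_chord_concave (R : realType) (f : R -> R) : F12 f ->
  chord_concave (derive1 f).
Proof.
move=> [_ _ _ _]; set g := derive1 f => cg x y z x0 xy yz.
have s0 : 0 <= (z - y) / (z - x) by rewrite divr_ge0; lra.
have s1 : (z - y) / (z - x) <= 1 by rewrite ler_pdivrMr; lra.
have := cg (Itv01 s0 s1) x z.
rewrite !inE /= !in_itv /= !andbT x0 (_ : 0 <= z); last lra.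
move=> /(_ isT isT); rewrite !convRE /= /unstable.onem.
set w := conv _ _ _; have -> : w = y.
  transitivity ((z - y) / (z - x) * x + (1 - (z - y) / (z - x)) * z) => //.
  by field; lra.
set s := (z - y) / (z - x).
have E : s * (z - x) = z - y by rewrite /s mulfVK//; lra.
move=> H.
have {}H : s * g x + (1 - s) * g z <= g y by lra.
nra.
Qed.

Lemma rquot_noninc (R : realType) (g : R -> R) (x h k : R) :
  chord_concave g -> 0 <= x -> 0 < h -> h <= k -> rquot g x k <= rquot g x h.
Proof.
move=> cg x0 h0; rewrite le_eqVlt => /orP[/eqP-> //|hk].
rewrite /rquot mulrC [leRHS]mulrC; have H := cg x (h + x) (k + x) x0.
rewrite ler_pdivrMr; last lra.
rewrite mulrAC ler_pdivlMr//.
have {H} := H _ _; rewrite ltrDr h0 ltrD2r hk => /(_ isT isT).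
by rewrite addrK (_ : k + x - (h + x) = k - h); [lra|ring].
Qed.

Lemma rquot_le_slope (R : realType) (g : R -> R) (x y h : R) :
  chord_concave g -> 0 <= x -> x < y -> 0 < h ->
  rquot g y h <= (g y - g x) / (y - x).
Proof.
move=> cg x0 xy h0; have := cg x y (h + y) x0 xy; rewrite ltrDr h0 addrK.
move=> /(_ isT) H; rewrite /rquot mulrC ler_pdivrMr// mulrAC.
by rewrite ler_pdivlMr; lra.
Qed.

(** The right difference quotients increase as h decreases to 0, and they stay
    below the slope of the chord from 0 to x, which exists because x > 0. *)
Lemma cvg_rquot (R : realType) (g : R -> R) (x : R) :
  chord_concave g -> 0 < x -> cvg (rquot g x @ 0^'+).
Proof.
move=> cg x0; apply/cvg_ex; eexists.
apply: (@nonincreasing_at_right_cvgr _ _ _ (BInfty _ false)) => //.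
  by move=> h k; rewrite !in_itv/= !andbT => *; apply: rquot_noninc => //; exact: ltW.
exists ((g x - g 0) / (x - 0)) => _ [h /= + <-]; rewrite in_itv/= andbT => h0.
exact: rquot_le_slope.
Qed.

Lemma rquot_le_rderive1 (R : realType) (g : R -> R) (x h : R) :
  chord_concave g -> 0 < x -> 0 < h -> rquot g x h <= rderive1 g x.
Proof.
move=> cg x0 h0; apply: limr_ge; first exact: cvg_rquot.
near=> k; apply: rquot_noninc => //; first exact: ltW.
by near: k; exact: nbhs_right_le.
Unshelve. all: by end_near. Qed.

Lemma rderive1_le_slope (R : realType) (g : R -> R) (x y : R) :
  chord_concave g -> 0 <= x -> x < y ->
  rderive1 g y <= (g y - g x) / (y - x).
Proof.
move=> cg x0 xy; apply: limr_le; first by apply: cvg_rquot => //; lra.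
by near=> h; apply: rquot_le_slope.
Unshelve. all: by end_near. Qed.

(** The right derivative squeezes the increments of g as the tails of a measure
    squeeze those of the integral of [dpsi]. *)
Lemma increment_rderive1 (R : realType) (g : R -> R) (x y : R) :
  chord_concave g -> 0 < x -> x <= y ->
  rderive1 g y * (y - x) <= g y - g x <= rderive1 g x * (y - x).
Proof.
move=> cg x0; rewrite le_eqVlt => /orP[/eqP->|xy]; first by rewrite !subrr !mulr0 lexx.
rewrite -ler_pdivlMr; last lra.
rewrite rderive1_le_slope//=; last exact: ltW.
have := @rquot_le_rderive1 _ g x (y - x) cg x0.
rewrite subr_gt0 xy => /(_ isT).
by rewrite /rquot subrK mulrC ler_pdivrMr// subr_gt0.
Qed.

Lemma rderive1_noninc (R : realType) (g : R -> R) (x y : R) :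
  chord_concave g -> 0 < x -> x <= y -> rderive1 g y <= rderive1 g x.
Proof.
move=> cg x0; rewrite le_eqVlt => /orP[/eqP->//|xy].
have /andP[A B] := increment_rderive1 cg x0 (ltW xy).
by rewrite -(ler_pM2r (x := y - x)) ?subr_gt0//; exact: le_trans A B.
Qed.

Lemma rderive1_ge0 (R : realType) (g : R -> R) (x : R) :
  chord_concave g -> {in `[0, +oo[ &, nondecreasing_fun g} -> 0 < x ->
  0 <= rderive1 g x.
Proof.
move=> cg ndg x0; apply: le_trans (rquot_le_rderive1 cg x0 ltr01).
rewrite /rquot invr1 mul1r subr_ge0; apply: ndg; rewrite ?in_itv/= ?andbT; lra.
Qed.

(** Right-continuity of the right derivative: a chord from x of slope above u
    keeps slope above u when its left end is moved slightly to the right, by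
    continuity of g, and the right derivative at the new end is larger still. *)
Lemma rderive1_right_lsc (R : realType) (g : R -> R) (u x : R) :
  chord_concave g -> continuous g -> 0 < x -> u < rderive1 g x ->
  exists2 y, x < y & u < rderive1 g y.
Proof.
move=> cg contg x0 ux.
have [h h0 uh] : exists2 h, 0 < h & u < rquot g x h.
  apply: contrapT => H; move: ux; rewrite ltNge => /negP; apply.
  apply: limr_le; first exact: cvg_rquot.
  by near=> h; rewrite leNgt; apply/negP => ?; apply: H; exists h.
have Hlt : (u * h + g x < g (h + x))%R.
  by move: uh; rewrite /rquot mulrC ltr_pdivlMr//; lra.
have cx : (u * (h + x - z) + g z) @[z --> x^'+] --> u * (h + x - x) + g x.
  apply: cvgD; last by apply: cvg_at_right_filter; exact: contg.
  apply: cvgMr; apply: cvgB; first exact: cvg_cst.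
  by apply: cvg_at_right_filter; exact: cvg_id.
near (x^'+) => z.
have xz : x < z by near: z; exact: nbhs_right_gt.
have zh : z < h + x by near: z; apply: nbhs_right_lt; rewrite ltrDr.
have Hz : u * (h + x - z) + g z < g (h + x).
  by near: z; apply: (cvgr_lt _ cx); rewrite addrK.
exists z => //.
have /andP[_] := increment_rderive1 cg (lt_trans x0 xz) (ltW zh) .
move=> H; rewrite -(ltr_pM2r (x := h + x - z)) ?subr_gt0//.
by apply: lt_le_trans H; lra.
Unshelve. all: by end_near. Qed.

(** On a subdivision of [a, b] of step d, the increments of A and B over
    [x, x + d] differ by at most (D x - D (x + d)) d. The sum telescopes to
    (D a - D b) d, which tends to 0 with d. *)
Lemma increment_unique (R : realType) (D A B : R -> R) (a b : R) : a <= b ->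
  (forall x y, a <= x -> x <= y ->
     D y * (y - x) <= A y - A x <= D x * (y - x)) ->
  (forall x y, a <= x -> x <= y ->
     D y * (y - x) <= B y - B x <= D x * (y - x)) ->
  A b - A a = B b - B a.
Proof.
move=> ab HA HB; pose w x := A x - B x.
have wD x y : a <= x -> x <= y -> `|w y - w x| <= (D x - D y) * (y - x).
  move=> ax xy; have /andP[? ?] := HA _ _ ax xy; have /andP[? ?] := HB _ _ ax xy.
  by rewrite ler_norml /w; apply/andP; split; lra.
suff : `|w b - w a| <= 0 by rewrite normr_le0 /w => /eqP; lra.
apply/ler_addgt0Pr => e e0; rewrite add0r.
pose c := (D a - D b) * (b - a).
have [n nc] : exists n : nat, c / e < n.+1%:R.
  by exists (Num.trunc (c / e)); exact: truncnS_gt.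
pose d := (b - a) / n.+1%:R.
have d0 : 0 <= d by rewrite divr_ge0// subr_ge0.
have xE i : a <= a + i%:R * d by rewrite lerDl mulr_ge0.
have step i : `|w (a + i%:R * d) - w a| <= (D a - D (a + i%:R * d)) * d.
  elim: i => [|i IH]; first by rewrite mulr0n mul0r addr0 !subrr normr0 mul0r.
  have E : a + i.+1%:R * d = a + i%:R * d + d by rewrite -natr1 mulrDl mul1r addrA.
  rewrite E; move: IH (wD _ (a + i%:R * d + d) (xE i)); set x := a + i%:R * d.
  rewrite lerDl d0 (addrAC x) subrr add0r => IH /(_ isT) S.
  have -> : w (x + d) - w a = (w (x + d) - w x) + (w x - w a) by ring.
  by apply: (le_trans (ler_normD _ _)); lra.
have := step n.+1; rewrite (_ : a + n.+1%:R * d = b); last first.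
  by rewrite /d mulrC mulfVK; [ring|rewrite pnatr_eq0].
move=> H; apply: (le_trans H).
rewrite /d mulrA -/c ler_pdivrMr//.
by move: nc; rewrite ltr_pdivrMr// => /ltW; rewrite mulrC.
Qed.

(** * Integrals of psi and of its derivative *)

Lemma measurable_pos_ereal (R : realType) : measurable (@pos_ereal R).
Proof. exact: emeasurable_itv. Qed.
#[local] Hint Extern 0 (measurable pos_ereal) => exact: measurable_pos_ereal : core.

Lemma measurable_dpsi (R : realType) (x : R) :
  measurable_fun (@pos_ereal R) (fun t => dpsi t x).
Proof.
apply: measurable_funM; first exact: measurable_cst.
apply: (measurableT_comp (f := @fine R)).
  exact: fine_measurable.
apply: measurable_maxe.
  exact: oppe_measurable.
apply: measurable_mine; [exact: measurable_cst|exact: measurable_id].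
Qed.

Lemma measurable_psi (R : realType) (x : R) :
  measurable_fun (@pos_ereal R) (fun t => psi t x).
Proof.
apply: measurable_funB; first exact: measurable_cst.
apply: measurable_funX.
apply: (measurableT_comp (f := @fine R)).
  exact: fine_measurable.
apply: measurable_maxe; first exact: measurable_cst.
apply: emeasurable_funB; [exact: measurable_cst|exact: measurable_id].
Qed.

Definition dpsi_integrable (R : realType)
    (gamma : {measure set (\bar R) -> \bar R}) :=
  gamma.-integrable pos_ereal (EFin \o (fun t => dpsi t 1)).

(** For t > 0, [dpsi t 1] is twice t /\ 1. *)
Lemma dpsi_integrableP (R : realType)
    (gamma : {measure set (\bar R) -> \bar R}) :
  dpsi_integrable gamma <-> (\int[gamma]_(t in pos_ereal) mine t 1 < +oo)%E.
Proof.
have E : (\int[gamma]_(t in pos_ereal) `|(dpsi t 1)%:E| =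
    2%:E * \int[gamma]_(t in pos_ereal) mine t 1)%E.
  rewrite -ge0_integralZl//; first last.
  - by move=> t /pos_erealE t0; rewrite le_min ltW//= lee01.
  - by apply: measurable_mine; [exact: measurable_id|exact: measurable_cst].
  apply: eq_integral => t /set_mem/pos_erealE t0.
  rewrite gee0_abs dpsi_ge0E// 1?minC// mule_ge0// le_min ltW//.
  by rewrite lee01.
split => [/integrableP[_]|fin].
  rewrite E; case: (integral _ _ _) => [r _||] //; first exact: ltry.
  by rewrite gt0_muley// lte_fin.
apply/integrableP; split.
  by apply/measurable_EFinP; exact: measurable_dpsi.
by rewrite E lte_mul_pinfty.
Qed.

Lemma integrable_dpsi (R : realType)
    (gamma : {measure set (\bar R) -> \bar R}) (x : R) :
  dpsi_integrable gamma ->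
  gamma.-integrable pos_ereal (EFin \o (fun t => dpsi t x)).
Proof.
move=> i1; apply: (@le_integrable _ _ _ _ _ _ _
  (EFin \o (fun t => (1 + `|x|) * dpsi t 1))) => //.
- by apply/measurable_EFinP; exact: measurable_dpsi.
- move=> t /pos_erealE t0 /=; rewrite lee_fin.
  exact: le_trans (dpsi_le_scale x t0) (ler_norm _).
- exact: (integrableZl (@measurable_pos_ereal R) (1 + `|x|) i1).
Qed.

Lemma integrable_dpsiZ (R : realType)
    (gamma : {measure set (\bar R) -> \bar R}) (k x : R) :
  dpsi_integrable gamma ->
  gamma.-integrable pos_ereal (EFin \o (fun t => k * dpsi t x)).
Proof.
by move=> /(integrable_dpsi x)/(integrableZl (@measurable_pos_ereal R) k).
Qed.

Lemma integrable_psi (R : realType)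
    (gamma : {measure set (\bar R) -> \bar R}) (x : R) :
  dpsi_integrable gamma ->
  gamma.-integrable pos_ereal (EFin \o (fun t => psi t x)).
Proof.
move=> /(integrable_dpsi x) ix; apply: (@le_integrable _ _ _ _ _ _ _
  (EFin \o (fun t => x * dpsi t x))) => //.
- by apply/measurable_EFinP; exact: measurable_psi.
- move=> t /pos_erealE t0 /=; rewrite lee_fin ger0_norm ?psi_ge0//.
  apply: le_trans (ler_norm _).
  by have := subgradient_psi x 0 t0; rewrite (psi0 t0); lra.
- exact: (integrableZl (@measurable_pos_ereal R) x ix).
Qed.

Definition int_dpsi (R : realType)
    (gamma : {measure set (\bar R) -> \bar R}) (x : R) : R :=
  \int[gamma]_(t in pos_ereal) dpsi t x.

Definition int_psi (R : realType)
    (gamma : {measure set (\bar R) -> \bar R}) (x : R) : R :=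
  \int[gamma]_(t in pos_ereal) psi t x.

Lemma int_dpsiE (R : realType) (gamma : {measure set (\bar R) -> \bar R})
    (x : R) : dpsi_integrable gamma ->
  (\int[gamma]_(t in pos_ereal) (dpsi t x)%:E = (int_dpsi gamma x)%:E)%E.
Proof.
move=> i1; rewrite /int_dpsi /Rintegral fineK//.
exact: (integrable_fin_num _ (integrable_dpsi x i1)).
Qed.

Lemma int_psiE (R : realType) (gamma : {measure set (\bar R) -> \bar R})
    (x : R) : dpsi_integrable gamma ->
  (\int[gamma]_(t in pos_ereal) (psi t x)%:E = (int_psi gamma x)%:E)%E.
Proof.
move=> i1; rewrite /int_psi /Rintegral fineK//.
exact: (integrable_fin_num _ (integrable_psi x i1)).
Qed.

Lemma representsP (R : realType) (gamma : {measure set (\bar R) -> \bar R})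
    (f : R -> R) :
  represents gamma f <->
  [/\ on_pos_ereal gamma, dpsi_integrable gamma & f = int_psi gamma].
Proof.
split=> [[g0 /dpsi_integrableP i1 fE]|[g0 i1 ->]]; split=> //.
- by apply/funext => x; have := fE x; rewrite int_psiE// => -[].
- exact/dpsi_integrableP.
- by move=> x; rewrite int_psiE.
Qed.

(** Near x the integrand is dominated by its value at |x| + 1, because
    [dpsi t] is monotone and odd. *)
Lemma continuous_int_dpsi (R : realType)
    (gamma : {measure set (\bar R) -> \bar R}) :
  dpsi_integrable gamma -> continuous (int_dpsi gamma).
Proof.
move=> i1 x.
apply: (@continuity_under_integral _ _ _ gamma (fun l t => dpsi t l) pos_ereal _
  (x - 1) (x + 1) _ _ (fun t => dpsi t (`|x| + 1))) => //.
- by move=> y _; exact: integrable_dpsi.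
- apply: aeW => t /pos_erealE t0 y _; exact: continuous_dpsi.
- exact: integrable_dpsi.
- move=> y /=; rewrite in_itv/= => /andP[xy yx]; apply: aeW => t /pos_erealE t0.
  have := ler_norm x; have := ler_norm (- x); rewrite normrN => *.
  by rewrite ler_norml -dpsiN// !dpsi_le//; lra.
- by rewrite inE /= in_itv/=; apply/andP; split; lra.
Qed.

Lemma is_derive_int_psi (R : realType)
    (gamma : {measure set (\bar R) -> \bar R}) (x : R) :
  dpsi_integrable gamma -> is_derive x 1 (int_psi gamma) (int_dpsi gamma x).
Proof.
move=> i1; apply: is_derive_subgradient; last exact: continuous_int_dpsi.
move=> {}x y; rewrite /int_dpsi mulrC -RintegralZl//; last exact: integrable_dpsi.
rewrite -RintegralB//; [|exact: integrable_psi..].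
apply: le_Rintegral => //.
- exact: integrable_dpsiZ.
- exact: (integrableB (@measurable_pos_ereal R)
    (integrable_psi y i1) (integrable_psi x i1)).
- by move=> t /pos_erealE t0; rewrite mulrC; exact: subgradient_psi.
Qed.

Lemma derive1_int_psi (R : realType)
    (gamma : {measure set (\bar R) -> \bar R}) :
  dpsi_integrable gamma -> derive1 (int_psi gamma) = int_dpsi gamma.
Proof.
move=> i1; apply/funext => x; rewrite derive1E.
by apply: derive_val; exact: is_derive_int_psi.
Qed.

(** Evenness, monotonicity and concavity of the kernel pass to the integral. *)
Lemma F12_int_psi (R : realType)
    (gamma : {measure set (\bar R) -> \bar R}) :
  dpsi_integrable gamma -> F12 (int_psi gamma).
Proof.
move=> i1; split.
- split; last by rewrite derive1_int_psi//; exact: continuous_int_dpsi.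
  by move=> x; apply: ex_derive; exact: is_derive_int_psi.
- have -> : int_psi gamma 0 = \int[gamma]_(t in pos_ereal) (cst 0) t.
    by apply: eq_Rintegral; move=> t /set_mem/pos_erealE t0; exact: psi0.
  by rewrite Rintegral_cst// mul0r.
- by move=> x; apply: eq_Rintegral => t _; exact: psiN.
- rewrite derive1_int_psi// => x y _ _ xy.
  apply: le_Rintegral; [|exact: integrable_dpsi|exact: integrable_dpsi|] => //.
  by move=> t /pos_erealE t0; exact: dpsi_le.
- rewrite derive1_int_psi// => s x y; rewrite !inE /= !in_itv/= !andbT => x0 y0.
  rewrite [leRHS]convRE /=; set w := conv _ _ _.
  have -> : w = s%:num * x + (1 - s%:num) * y by [].
  rewrite !mulrN -opprD lerN2 /unstable.onem /int_dpsi.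
  rewrite -!RintegralZl//; [|exact: integrable_dpsi..].
  rewrite -RintegralD//; [|exact: integrable_dpsiZ..].
  apply: le_Rintegral => //.
  + by apply: (integrableD (@measurable_pos_ereal R) (integrable_dpsiZ _ _ i1)
      (integrable_dpsiZ _ _ i1)).
  + exact: integrable_dpsi.
  + move=> t /pos_erealE t0; apply: dpsi_concave => //.
    by apply/andP; split.
Qed.

(** * Tails of the measure *)

Definition tail (R : realType) (x : R) : set (\bar R) := `]x%:E, +oo%E]%classic.

Lemma tailE (R : realType) (x : R) (t : \bar R) : tail x t <-> (x%:E < t)%E.
Proof. by rewrite /tail/= in_itv/= leey andbT. Qed.

Lemma measurable_tail (R : realType) (x : R) : measurable (tail x).
Proof. exact: emeasurable_itv. Qed.
#[local] Hint Extern 0 (measurable (tail _)) => exact: measurable_tail : core.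

Lemma indic_tail (R : realType) (x : R) (t : \bar R) :
  \1_(tail x) t = (x%:E < t)%E%:R :> R.
Proof.
rewrite indicE; congr (nat_of_bool _)%:R.
by apply/idP/idP => [/set_mem/tailE//|?]; apply/mem_set/tailE.
Qed.

Lemma measurable_indic_tail (R : realType) (x : R) (D : set (\bar R)) :
  measurable_fun D (fun t => (x%:E < t)%E%:R : R).
Proof.
have -> : (fun t => (x%:E < t)%E%:R : R) = \1_(tail x).
  by apply/funext => t; rewrite indic_tail.
exact: measurable_indic.
Qed.

Lemma tailI (R : realType) (x y : R) : tail x `&` tail y = tail (Num.max x y).
Proof.
apply/seteqP; split=> t /=; rewrite !tailE EFin_max gt_max; first by case=> -> ->.
by move/andP.
Qed.

Lemma sub_tail (R : realType) (x y : R) : x <= y -> tail y `<=` tail x.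
Proof. by move=> xy t; rewrite !tailE; apply: le_lt_trans; rewrite lee_fin. Qed.

Lemma bigcup_tail (R : realType) (x : R) :
  \bigcup_n tail (x + n.+1%:R^-1) = tail x.
Proof.
apply/seteqP; split=> [t [n _]|t /tailE].
  by apply: sub_tail; rewrite lerDl.
case: t => [r||] //; last by exists 0%N => //; apply/tailE; rewrite ltry.
rewrite lte_fin => xr; exists (Num.trunc (r - x)^-1) => //; apply/tailE.
rewrite lte_fin -ltrBrDl invf_plt ?posrE ?subr_gt0//.
exact: truncnS_gt.
Qed.

(** Continuity from below. At x = 0 it recovers gamma from its restrictions to
    the rays ]1/n, +oo], which may be finite when gamma is not. *)
Lemma cvg_tail (R : realType) (gamma : {measure set (\bar R) -> \bar R})
    (x : R) (A : set (\bar R)) : measurable A ->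
  gamma (A `&` tail (x + n.+1%:R^-1)) @[n --> \oo] --> gamma (A `&` tail x).
Proof.
move=> mA; rewrite -bigcup_tail setI_bigcupr.
apply: nondecreasing_cvg_mu.
- by move=> n; exact: measurableI.
- by apply: bigcupT_measurable => n; exact: measurableI.
- move=> m n mn; apply/subsetPset; apply: setIS; apply: sub_tail.
  by rewrite lerD2l lef_pV2 ?posrE// ler_nat ltnS.
Qed.

Lemma tail_le (R : realType) (gamma : {measure set (\bar R) -> \bar R})
    (x : R) (c : \bar R) :
  (forall y, x < y -> (gamma (tail y) <= c)%E) -> (gamma (tail x) <= c)%E.
Proof.
move=> H; have := @cvg_tail _ gamma x _ measurableT; rewrite !setTI => cv.
apply: (cvge_to_le cv); near=> n; rewrite setTI; apply: H.
by rewrite ltrDl invr_gt0.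
Unshelve. all: by end_near. Qed.

Lemma integral_tail (R : realType) (gamma : {measure set (\bar R) -> \bar R})
    (x : R) : 0 <= x ->
  (\int[gamma]_(t in pos_ereal) ((x%:E < t)%E%:R : R)%:E = gamma (tail x))%E.
Proof.
move=> x0; have sub : tail x `<=` pos_ereal.
  by move=> t /tailE xt; apply/pos_erealE; apply: le_lt_trans xt; rewrite lee_fin.
rewrite -[in RHS](setIidl sub) -integral_indic//.
by apply: eq_integral => t _; rewrite indic_tail.
Qed.

Lemma integrable_tail (R : realType)
    (gamma : {measure set (\bar R) -> \bar R}) (x : R) : 0 <= x ->
  (gamma (tail x) < +oo)%E ->
  gamma.-integrable pos_ereal (EFin \o (fun t => (x%:E < t)%E%:R)).
Proof.
move=> x0 fin; apply/integrableP; split.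
  by apply/measurable_EFinP; exact: measurable_indic_tail.
rewrite (le_lt_trans _ fin)// -integral_tail//.
by under eq_integral do rewrite /= ger0_norm//.
Qed.

Lemma Rintegral_tail (R : realType)
    (gamma : {measure set (\bar R) -> \bar R}) (x c : R) : 0 <= x ->
  (gamma (tail x) < +oo)%E ->
  \int[gamma]_(t in pos_ereal) (c * (x%:E < t)%E%:R) = c * fine (gamma (tail x)).
Proof.
move=> x0 fin; rewrite RintegralZl//; last exact: integrable_tail.
by rewrite /Rintegral integral_tail.
Qed.

Lemma integrable_dpsi_incr (R : realType)
    (gamma : {measure set (\bar R) -> \bar R}) (x y : R) : 0 <= x -> x <= y ->
  (gamma (tail x) < +oo)%E ->
  gamma.-integrable pos_ereal (EFin \o (fun t => dpsi t y - dpsi t x)).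
Proof.
move=> x0 xy /(integrable_tail x0)
  /(integrableZl (@measurable_pos_ereal R) (2 * (y - x))) it.
apply: le_integrable it => //.
- apply/measurable_EFinP; apply: measurable_funB; exact: measurable_dpsi.
- move=> t /pos_erealE t0 /=; rewrite lee_fin.
  have /andP[_ H] := dpsi_incr t0 x0 xy.
  rewrite ger0_norm ?subr_ge0 ?dpsi_le//.
  exact: le_trans H (ler_norm _).
Qed.

Lemma Rintegral_dpsi_incr (R : realType)
    (gamma : {measure set (\bar R) -> \bar R}) (x y : R) : 0 <= x -> x <= y ->
  (gamma (tail x) < +oo)%E ->
  2 * (y - x) * fine (gamma (tail y)) <=
  \int[gamma]_(t in pos_ereal) (dpsi t y - dpsi t x) <=
  2 * (y - x) * fine (gamma (tail x)).
Proof.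
move=> x0 xy finx.
have y0 := le_trans x0 xy.
have finy : (gamma (tail y) < +oo)%E.
  apply: le_lt_trans finx; apply: le_measure; rewrite ?inE//; exact: sub_tail.
rewrite -!Rintegral_tail//; apply/andP; split; apply: le_Rintegral => //.
- exact: (integrableZl (@measurable_pos_ereal R) (2 * (y - x))
    (integrable_tail y0 finy)).
- exact: integrable_dpsi_incr.
- by move=> t /pos_erealE t0; have /andP[] := dpsi_incr t0 x0 xy.
- exact: integrable_dpsi_incr.
- exact: (integrableZl (@measurable_pos_ereal R) (2 * (y - x))
    (integrable_tail x0 finx)).
- by move=> t /pos_erealE t0; have /andP[] := dpsi_incr t0 x0 xy.
Qed.

Lemma tail_lty (R : realType) (gamma : {measure set (\bar R) -> \bar R})
    (x : R) : dpsi_integrable gamma -> 0 < x -> (gamma (tail x) < +oo)%E.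
Proof.
move=> i1 x0; rewrite -integral_tail ?ltW//.
have /integrableP[_] := integrable_dpsiZ x^-1 x i1.
apply: le_lt_trans; apply: ge0_le_integral => //.
- by apply/measurable_EFinP; exact: measurable_indic_tail.
- apply: measurableT_comp => //.
  by have /integrableP[] := integrable_dpsiZ x^-1 x i1.
- move=> t /pos_erealE t0 /=; rewrite lee_fin; apply: le_trans (ler_norm _).
  exact: indic_le_dpsi.
Qed.

(** The difference quotient of H at x with step h lies between the doubled
    tails at x + h and at x. The upper bound passes to the limit at once; for
    the lower one, the tail at x is the supremum of the tails at y > x. *)
Lemma tail_int_dpsi (R : realType)
    (gamma : {measure set (\bar R) -> \bar R}) (x : R) :
  dpsi_integrable gamma -> 0 < x ->
  gamma (tail x) = (2^-1 * rderive1 (int_dpsi gamma) x)%:E.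
Proof.
move=> i1 x0; set g := int_dpsi gamma.
have cg : chord_concave g.
  by rewrite /g -derive1_int_psi//; apply: F12_chord_concave; exact: F12_int_psi.
have bound h : 0 < h -> 2 * fine (gamma (tail (h + x))) <= rquot g x h <=
    2 * fine (gamma (tail x)).
  move=> h0; have xhx : x <= h + x by rewrite lerDr ltW.
  have := Rintegral_dpsi_incr (ltW x0) xhx (tail_lty i1 x0).
  rewrite RintegralB//; [|exact: integrable_dpsi..].
  rewrite -/(int_dpsi _ _) -/(int_dpsi _ _) addrK /rquot -/g mulrC [h^-1 * _]mulrC.
  move: (g (h + x) - g x) => w /andP[A B].
  by rewrite ler_pdivlMr// ler_pdivrMr//; apply/andP; split; lra.
have fin y : x <= y -> (gamma (tail y)) \is a fin_num.
  by move=> xy; rewrite ge0_fin_numE//; apply: tail_lty => //; exact: lt_le_trans xy.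
apply/eqP; rewrite eq_le; apply/andP; split.
  apply: tail_le => y xy; rewrite -(fineK (fin y (ltW xy))) lee_fin.
  have h0 : 0 < y - x by rewrite subr_gt0.
  have := rquot_le_rderive1 cg x0 h0; have /andP[+ _] := bound _ h0.
  by rewrite subrK; lra.
rewrite -(fineK (fin x (lexx x))) lee_fin.
suff : rderive1 g x <= 2 * fine (gamma (tail x)) by lra.
apply: limr_le; first exact: cvg_rquot.
near=> h; have h0 : 0 < h by near: h; exact: nbhs_right_gt.
by have /andP[] := bound h h0.
Unshelve. all: by end_near. Qed.

(** Integrability of [dpsi t x] is not yet known here: only tails at positive
    points are finite. Differences [dpsi t x - dpsi t e] with e > 0 are bounded
    and supported in ]e, +oo], hence integrable; monotone convergence as e
    tends to 0 then yields the value and, with it, integrability. *)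
Lemma int_dpsi_of_tail (R : realType)
    (gamma : {measure set (\bar R) -> \bar R}) (g : R -> R) :
  chord_concave g -> continuous g -> g 0 = 0 ->
  (forall x, 0 < x -> gamma (tail x) = (2^-1 * rderive1 g x)%:E) ->
  forall x, 0 <= x -> (\int[gamma]_(t in pos_ereal) (dpsi t x)%:E = (g x)%:E)%E.
Proof.
move=> cg contg g0 gE x; rewrite le_eqVlt => /orP[/eqP <-|x0].
  rewrite g0; apply: integral0_eq => t /pos_erealE t0.
  by rewrite dpsi0.
have fin y : 0 < y -> (gamma (tail y) < +oo)%E by move=> y0; rewrite gE ?ltry.
have diff e : 0 < e -> e <= x ->
    \int[gamma]_(t in pos_ereal) (dpsi t x - dpsi t e) = g x - g e.
  move=> e0 ex.
  (* For e <= y <= x, the integral of dpsi t y - dpsi t e has the same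
     increments as g, both being squeezed by rderive1 g. *)
  have base : \int[gamma]_(t in pos_ereal) (dpsi t e - dpsi t e) = 0.
    under eq_Rintegral do rewrite subrr.
    by rewrite Rintegral_cst// mul0r.
  rewrite -[LHS]subr0 -[X in _ - X]base.
  pose A y := \int[gamma]_(t in pos_ereal) (dpsi t y - dpsi t e).
  apply: (@increment_unique _ (rderive1 g) A g e x ex) => y z ey yz.
    have y0 : 0 < y by exact: lt_le_trans ey.
    have ez := le_trans ey yz.
    rewrite /A -RintegralB//; last 2 first.
    - by apply: integrable_dpsi_incr => //; [exact: ltW|exact: fin].
    - by apply: integrable_dpsi_incr => //; [exact: ltW|exact: fin].
    have -> : \int[gamma]_(t in pos_ereal)
        (dpsi t z - dpsi t e - (dpsi t y - dpsi t e)) =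
        \int[gamma]_(t in pos_ereal) (dpsi t z - dpsi t y).
      by apply: eq_Rintegral => t _; ring.
    have := Rintegral_dpsi_incr (ltW y0) yz (fin y y0).
    rewrite !gE//=; last exact: lt_le_trans yz.
    move: (rderive1 g y) (rderive1 g z) => Dy Dz.
    by move: (Rintegral _ _ _) => I /andP[? ?]; apply/andP; split; lra.
  by apply: increment_rderive1 => //; exact: lt_le_trans ey.
(* The sequence e n decreases to 0 and starts at x, so that e n <= x. *)
pose e n := x / n.+1%:R.
have e0 n : 0 < e n by rewrite divr_gt0.
have ex n : e n <= x by rewrite ler_pdivrMr// ler_peMr ?ler1n// ltW.
have ecvg : e n @[n --> \oo] --> 0.
  rewrite -[X in _ --> X](mulr0 x); apply: cvgMr; exact: cvg_harmonic.
pose F n t := (dpsi t x - dpsi t (e n))%:E.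
have FE n : (\int[gamma]_(t in pos_ereal) F n t = (g x - g (e n))%:E)%E.
  rewrite -diff// /Rintegral fineK//.
  by apply: integrable_fin_num => //; apply: integrable_dpsi_incr => //;
    [exact: ltW|exact: fin].
have mF n : measurable_fun pos_ereal (F n).
  apply/measurable_EFinP; apply: measurable_funB; exact: measurable_dpsi.
have F0 n t : pos_ereal t -> (0 <= F n t)%E.
  by move=> /pos_erealE t0; rewrite lee_fin subr_ge0 dpsi_le.
have Fnd t : pos_ereal t -> {homo F^~ t : m n / (m <= n)%N >-> (m <= n)%E}.
  move=> /pos_erealE t0 m n mn; rewrite lee_fin lerD2l lerN2 dpsi_le//.
  by rewrite ler_pM2l// lef_pV2 ?posrE// ler_nat ltnS.
have cvF : (fun n => \int[gamma]_(t in pos_ereal) F n t)%E @ \oo -->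
    (\int[gamma]_(t in pos_ereal) limn (F^~ t))%E.
  exact: (cvg_monotone_convergence (@measurable_pos_ereal R) mF F0 Fnd).
move: cvF; rewrite (funext FE).
have -> : (\int[gamma]_(t in pos_ereal) limn (F^~ t) =
    \int[gamma]_(t in pos_ereal) (dpsi t x)%:E)%E.
  apply: eq_integral => t /set_mem/pos_erealE t0; apply: cvg_lim => //.
  apply: cvg_EFin; first by near=> n.
  rewrite -[X in _ --> X]subr0 -(dpsi0 t0) /F /=.
  apply: cvgB; first exact: cvg_cst.
  exact: (continuous_cvg _ (@continuous_dpsi _ _ t0 0) ecvg).
move=> cv; have cv' : (g x - g (e n))%:E @[n --> \oo] --> (g x - g 0)%:E.
  apply: cvg_EFin; first by near=> n.
  apply: cvgB; first exact: cvg_cst.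
  exact: (continuous_cvg _ (contg 0) ecvg).
have := cvg_unique _ cv cv'; rewrite g0 subr0; apply.
Unshelve. all: by end_near. Qed.

(** * Uniqueness and existence of a measure with given tails *)

(** The whole space is added to the rays because no ray contains -oo, while the
    uniqueness theorem needs a cover by generators. *)
Lemma measurable_tails (R : realType) :
  @measurable _ (\bar R) = <<s [set A | A = setT \/ exists r : R, A = tail r] >>.
Proof.
apply/seteqP; split.
  rewrite [X in X `<=` _](ErealGenOInfty.measurableE R).
  apply: sub_sigma_algebra2 => A [r ->]; right; exists r.
  apply/seteqP; split=> t; [move=> rt; apply/tailE|move=> /tailE rt]; move: rt;
    by rewrite /= in_itv/= andbT.
apply: smallest_sub; first exact: sigma_algebra_measurable.
by move=> A [->|[r ->]].
Qed.

(** The measures may be infinite near 0, so they are compared after restriction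
    to ]1/n, +oo], where they are finite. *)
Lemma measure_eq_of_tails (R : realType)
    (gamma gamma' : {measure set (\bar R) -> \bar R}) :
  on_pos_ereal gamma -> on_pos_ereal gamma' ->
  (forall x : R, 0 < x -> gamma (tail x) = gamma' (tail x)) ->
  (forall x : R, 0 < x -> (gamma (tail x) < +oo)%E) ->
  forall A, measurable A -> gamma A = gamma' A.
Proof.
move=> g0 g0' eqt fin A mA.
have posI (m : {measure set (\bar R) -> \bar R}) : on_pos_ereal m ->
    m A = m (A `&` tail 0).
  move=> m0; rewrite [LHS](measureDI m mA (@measurable_pos_ereal R)).
  rewrite [X in (X + _)%E](_ : _ = 0%E) ?add0e//.
  by apply: (subset_measure0 _ _ _ m0);
    [exact: measurableD|exact: measurableC|rewrite setDE].
rewrite (posI _ g0) (posI _ g0').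
have c := @cvg_tail _ gamma 0 _ mA; have c' := @cvg_tail _ gamma' 0 _ mA.
suff E : (fun n : nat => gamma (A `&` tail (0 + n.+1%:R^-1))) =
         (fun n : nat => gamma' (A `&` tail (0 + n.+1%:R^-1))).
  by rewrite E in c; apply: cvg_unique c c'.
apply/funext => n; rewrite add0r; set e := n.+1%:R^-1.
have e0 : 0 < e by rewrite invr_gt0.
apply: (@measure_unique _ _ _
  [set A | A = setT \/ exists r : R, A = tail r] (fun=> setT)
  (@measurable_tails R) _ _ _
  (mrestr gamma (measurable_tail e)) (mrestr gamma' (measurable_tail e))) => //.
- move=> _ _ [->|[r ->]] [->|[s ->]].
  + by left; rewrite setTI.
  + by right; exists s; rewrite setTI.
  + by right; exists r; rewrite setIT.
  + by right; exists (Num.max r s); rewrite tailI.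
- by move=> _; left.
- by rewrite bigcup_const.
- move=> _ [->|[r ->]].
    change (gamma (setT `&` tail e) = gamma' (setT `&` tail e)).
    by rewrite setTI eqt.
  change (gamma (tail r `&` tail e) = gamma' (tail r `&` tail e)).
  by rewrite tailI eqt// lt_max e0 orbT.
- move=> _; change (gamma (setT `&` tail e) < +oo)%E.
  by rewrite setTI; exact: fin.
Qed.

(** Quantile transform: with Q u the supremum of the y > 0 such that u < G y,
    the hypotheses on G say that x < Q u exactly when u < G x, so the image of
    Lebesgue measure on ]0, +oo[ under Q gives ]x, +oo] the measure of
    ]0, G x[. The image may also charge +oo, when G does not tend to 0. *)
Lemma measure_of_tails (R : realType) (G : R -> R) :
  (forall x, 0 < x -> 0 <= G x) ->
  (forall x y, 0 < x -> x <= y -> G y <= G x) ->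
  (forall u x, 0 < x -> u < G x -> exists2 y, x < y & u < G y) ->
  exists gamma : {measure set (\bar R) -> \bar R},
    on_pos_ereal gamma /\ forall x, 0 < x -> gamma (tail x) = (G x)%:E.
Proof.
move=> G0 Gni Glsc.
pose Q u : \bar R := ereal_sup [set y%:E | y in [set y | 0 < y /\ u < G y]].
have QE u x : 0 < x -> (x%:E < Q u)%E <-> u < G x.
  move=> x0; split.
    move=> /ereal_sup_gt[_ [y [y0 uy] <-]]; rewrite lte_fin => xy.
    by apply: (lt_le_trans uy); apply: Gni => //; exact: ltW.
  move=> /(Glsc _ _ x0)[y xy uy]; apply: (@lt_le_trans _ _ y%:E).
    by rewrite lte_fin.
  by apply: ereal_sup_ubound; exists y => //; split=> //; exact: lt_trans xy.
have Qni u v : u <= v -> (Q v <= Q u)%E.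
  move=> uv; apply: ereal_sup_le => _ [y [y0 vy] <-].
  by exists y => //; split=> //; exact: le_lt_trans vy.
have mQ : measurable_fun [set: R] Q.
  move=> mT; apply: (measurability _ (ErealGenOInfty.measurableE R)) => //.
  move=> _ [_ [r ->] <-]; rewrite setTI.
  apply: is_interval_measurable => s t; rewrite /= !in_itv/= !andbT.
  by move=> _ rt u /andP[_ ut]; rewrite in_itv/= andbT (lt_le_trans rt)// Qni.
(* The levels u above all values of G have Q u = -oo; restricting to D
   discards them. *)
pose D := `]0, +oo[%classic `&` Q @^-1` (@pos_ereal R).
have mD : measurable D.
  apply: measurableI => //; rewrite -[X in measurable X]setTI; exact: mQ.
unshelve eexists (pushforward (mrestr lebesgue_measure mD) Q
  : {measure set _ -> \bar R}); first exact: mQ.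
split=> [|x x0].
  change (lebesgue_measure (Q @^-1` (~` pos_ereal) `&` D) = 0%E).
  rewrite (_ : _ `&` _ = set0) ?measure0//.
  by apply/seteqP; split=> u // [nQ [_ Qu]]; exact: nQ.
change (lebesgue_measure (Q @^-1` (tail x) `&` D) = (G x)%:E).
have -> : Q @^-1` (tail x) `&` D = `]0, G x[%classic.
  apply/seteqP; split=> u.
    move=> [/tailE/(QE _ _ x0) uG [u0 _]].
    by move: u0; rewrite /= !in_itv/= andbT uG => ->.
  rewrite /= in_itv/= => /andP[u0 uG]; have xQ := (QE u x x0).2 uG.
  split; first exact/tailE; split; first by rewrite /= in_itv/= u0.
  by apply/pos_erealE; apply: lt_trans xQ; rewrite lte_fin.
rewrite lebesgue_measure_itv/= lte_fin; have := G0 x x0.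
by rewrite le_eqVlt => /orP[/eqP<-|->]; rewrite ?ltxx// -EFinB subr0.
Qed.

(** * The representation *)

Lemma derive1_even (R : realType) (f : R -> R) :
  (forall x, derivable f x 1) -> (forall x, f (- x) = f x) ->
  forall x, derive1 f (- x) = - derive1 f x.
Proof.
move=> df ef x.
have E : derive1 (f \o (fun y => - y)) x = derive1 f (- x) * - 1.
  rewrite derive1_comp//.
  by congr (_ * _); rewrite derive1E; exact: derive_val.
have -> : derive1 f x = derive1 (f \o (fun y => - y)) x.
  by congr (derive1 _ x); apply/funext => y /=; rewrite ef.
by rewrite E mulrN1 opprK.
Qed.

Lemma F12_derive1_0 (R : realType) (f : R -> R) : F12 f -> derive1 f 0 = 0.
Proof.
move=> [[df _] _ ef _ _]; have := derive1_even df ef 0.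
by rewrite oppr0; lra.
Qed.

(** The derivatives of f and of the integral of [psi] agree on [0, +oo[ by
    [int_dpsi_of_tail], then everywhere as both are odd; both functions vanish
    at 0. *)
Lemma represents_of_tail (R : realType) (f : R -> R)
    (gamma : {measure set (\bar R) -> \bar R}) :
  F12 f -> on_pos_ereal gamma ->
  (forall x, 0 < x -> gamma (tail x) = (2^-1 * rderive1 (derive1 f) x)%:E) ->
  represents gamma f.
Proof.
move=> Ff gamma0 gE; have [[df cdf] f0 ef _ _] := Ff.
have intE := int_dpsi_of_tail (F12_chord_concave Ff) cdf (F12_derive1_0 Ff) gE.
have i1 : dpsi_integrable gamma.
  apply/integrableP; split.
    by apply/measurable_EFinP; exact: measurable_dpsi.
  rewrite (_ : integral _ _ _ = (derive1 f 1)%:E) ?ltry// -(intE 1 ler01).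
  apply: eq_integral => t /set_mem/pos_erealE t0 /=.
  by rewrite ger0_norm// -(dpsi0 t0) dpsi_le.
have dE x : 0 <= x -> derive1 f x = int_dpsi gamma x.
  by move=> x0; have := intE x x0; rewrite int_dpsiE// => -[].
have idN x : int_dpsi gamma (- x) = - int_dpsi gamma x.
  rewrite -derive1_int_psi//; apply: derive1_even.
    by move=> y; apply: ex_derive; exact: is_derive_int_psi.
  by move=> y; have [_ _ -> _ _] := F12_int_psi i1.
have {}dE x : derive1 f x = int_dpsi gamma x.
  have [x0|x0] := leP 0 x; first exact: dE.
  have Nx0 : 0 <= - x by rewrite oppr_ge0 ltW.
  have fN := derive1_even df ef x; have HN := idN x; have EN := dE _ Nx0.
  by apply: oppr_inj; rewrite -fN -HN.
apply/representsP; split=> //; apply/funext => x.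
have [_ p0 _ _ _] := F12_int_psi i1.
suff : f x - int_psi gamma x = f 0 - int_psi gamma 0.
  by rewrite f0 p0 subrr => /eqP; rewrite subr_eq0 => /eqP.
apply: (@is_derive_0_is_cst _ (fun x => f x - int_psi gamma x)) => y.
rewrite -(subrr (int_dpsi gamma y)).
apply: is_deriveB; last exact: is_derive_int_psi.
by rewrite -dE derive1E; exact: derivableP.
Qed.

Lemma tail_of_represents (R : realType) (f : R -> R)
    (gamma : {measure set (\bar R) -> \bar R}) :
  represents gamma f -> forall x, 0 < x ->
  gamma (tail x) = (2^-1 * rderive1 (derive1 f) x)%:E.
Proof.
move=> /representsP[_ i1 ->] x x0.
by rewrite derive1_int_psi// tail_int_dpsi.
Qed.

Lemma exists_represents (R : realType) (f : R -> R) : F12 f ->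
  exists gamma : {measure set (\bar R) -> \bar R}, represents gamma f.
Proof.
move=> Ff; have [[_ cdf] _ _ ndf _] := Ff; have cc := F12_chord_concave Ff.
have [x x0|x y x0 xy|u x x0 ux|gamma [gamma0 gE]] :=
    @measure_of_tails R (fun x => 2^-1 * rderive1 (derive1 f) x).
- by apply: mulr_ge0; [rewrite invr_ge0|exact: rderive1_ge0].
- by apply: ler_wpM2l; [rewrite invr_ge0|exact: rderive1_noninc].
- have half (d : R) : u < 2^-1 * d <-> 2 * u < d by split=> ?; lra.
  have [y xy /half uy] := rderive1_right_lsc cc cdf x0 ((half _).1 ux).
  by exists y.
- by exists gamma; exact: represents_of_tail.
Qed.

Theorem proposition1p2 (R : realType) :
  (* (I) *)
  ((forall f : R -> R,
      F12 f <->
      exists gamma : {measure set (\bar R) -> \bar R}, represents gamma f) /\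
   {uniform, (fun t x : R => (2 * t)^-1 * psi t%:E x) @ 0^'+ -->
             (fun x : R => `|x|)}) /\
  (* (II) *)
  (forall f : R -> R, F12 f ->
     (forall x : R, 0 < x -> cvg (rquot (derive1 f) x @ 0^'+)) /\
     (forall gamma gamma' : {measure set (\bar R) -> \bar R},
        represents gamma f -> represents gamma' f ->
        forall A : set (\bar R), measurable A -> gamma A = gamma' A) /\
     (forall gamma : {measure set (\bar R) -> \bar R},
        on_pos_ereal gamma ->
        (represents gamma f <->
         forall x : R, 0 < x ->
           gamma `]x%:E, +oo%E]%classic = (2^-1 * rderive1 (derive1 f) x)%:E))) /\
  (* (III) *)
  ((forall (t : \bar R) (x : R), (0 < t)%E -> derivable (psi t) x 1) /\
   (forall (f : R -> R) (gamma : {measure set (\bar R) -> \bar R}),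
      F12 f -> represents gamma f ->
      forall x : R, 0 <= x ->
        (derive1 f x)%:E = (\int[gamma]_(t in pos_ereal) (derive1 (psi t) x)%:E)%E /\
        (\int[gamma]_(t in pos_ereal) (derive1 (psi t) x)%:E =
           2%:E * \int[gamma]_(t in pos_ereal) mine x%:E t)%E)).
Proof.
split; first split.
- move=> f; split; first exact: exists_represents.
  by move=> [gamma /representsP[_ i1 ->]]; exact: F12_int_psi.
- exact: cvg_psi_abs.
split.
- move=> f Ff; split.
    by move=> x x0; apply: cvg_rquot => //; exact: F12_chord_concave.
  split.
    move=> gamma gamma' r r'; have [g0 _ _] := r; have [g0' _ _] := r'.
    apply: measure_eq_of_tails => // x x0.
      by rewrite (tail_of_represents r)// (tail_of_represents r').
    by rewrite (tail_of_represents r)// ltry.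
  move=> gamma g0; split; first exact: tail_of_represents.
  exact: represents_of_tail.
split; first by move=> t x t0; apply: ex_derive; exact: is_derive_psi.
move=> f gamma _ /representsP[_ i1 ->] x x0; rewrite derive1_int_psi//.
have -> : (\int[gamma]_(t in pos_ereal) (derive1 (psi t) x)%:E =
           \int[gamma]_(t in pos_ereal) (dpsi t x)%:E)%E.
  by apply: eq_integral => t /set_mem/pos_erealE t0; rewrite derive1_psi.
rewrite int_dpsiE//; split=> //.
rewrite -int_dpsiE// -ge0_integralZl//; first last.
- by move=> t /pos_erealE t0; rewrite le_min lee_fin x0 ltW.
- by apply: measurable_mine; [exact: measurable_cst|exact: measurable_id].
by apply: eq_integral => t /set_mem/pos_erealE t0; rewrite dpsi_ge0E.
Qed.
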